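(* Let $X$ be a strictly convex Banach space and let $f: X \to X$ be Lipschitz continuous with constant $L$, i.e. $\|f(x)-f(y)\|_X \le L\|x-y\|_X$ for all $x,y\in X$. Let $x:\mathbb{R}\to X$ be a non-constant $T$-periodic solution (with $T>0$) of the ordinary differential equation $\dot x = f(x)$. Then $$TL > 6.$$
   Context: A Banach space is strictly convex if its closed unit ball is a strictly convex set, i.e. $\|x\|=\|y\|=1$ and $x\neq y$ imply $\|(x+y)/2\|<1$; equivalently, $\|u+v\|=\|u\|+\|v\|$ with $u,v\neq 0$ implies $u=\lambda v$ for some $\lambda>0$. *)

(* Defs.v *)
From Stdlib Require Import Reals.
Open Scope R_scope.

Record NormedSpace := {
  carrier :> Type;
  vzero : carrier;
  vadd : carrier -> carrier -> carrier;
  vopp : carrier -> carrier;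
  vscal : R -> carrier -> carrier;
  vnorm : carrier -> R;
  vadd_assoc : forall u v w, vadd u (vadd v w) = vadd (vadd u v) w;
  vadd_comm : forall u v, vadd u v = vadd v u;
  vadd_0 : forall u, vadd u vzero = u;
  vadd_opp : forall u, vadd u (vopp u) = vzero;
  vscal_assoc : forall a b u, vscal a (vscal b u) = vscal (a * b) u;
  vscal_1 : forall u, vscal 1 u = u;
  vscal_distr_v : forall a u v, vscal a (vadd u v) = vadd (vscal a u) (vscal a v);
  vscal_distr_r : forall a b u, vscal (a + b) u = vadd (vscal a u) (vscal b u);
  vnorm_eq0 : forall u, vnorm u = 0 -> u = vzero;
  vnorm_scal : forall a u, vnorm (vscal a u) = Rabs a * vnorm u;
  vnorm_triangle : forall u v, vnorm (vadd u v) <= vnorm u + vnorm v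
}.

Arguments vzero {n}.
Arguments vadd {n}.
Arguments vopp {n}.
Arguments vscal {n}.
Arguments vnorm {n}.

Definition vsub {X : NormedSpace} (u v : X) : X := vadd u (vopp v).

Definition complete (X : NormedSpace) : Prop :=
  forall u : nat -> X,
    (forall eps, eps > 0 -> exists N, forall m n, (m >= N)%nat -> (n >= N)%nat ->
        vnorm (vsub (u m) (u n)) < eps) ->
    exists l : X, forall eps, eps > 0 -> exists N, forall n, (n >= N)%nat ->
        vnorm (vsub (u n) l) < eps.

Definition strictly_convex (X : NormedSpace) : Prop :=
  forall u v : X, vnorm u = 1 -> vnorm v = 1 -> u <> v ->
    vnorm (vscal (1/2) (vadd u v)) < 1.

Definition lipschitz {X : NormedSpace} (f : X -> X) (L : R) : Prop :=
  forall u v : X, vnorm (vsub (f u) (f v)) <= L * vnorm (vsub u v).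

Definition has_derivative_at {X : NormedSpace} (x : R -> X) (t : R) (d : X) : Prop :=
  forall eps, eps > 0 -> exists delta, delta > 0 /\
    forall h, h <> 0 -> Rabs h < delta ->
      vnorm (vsub (vscal (/ h) (vsub (x (t + h)) (x t))) d) < eps.

Definition solves_ode {X : NormedSpace} (f : X -> X) (x : R -> X) : Prop :=
  forall t, has_derivative_at x t (f (x t)).

(* Main.v *)
Require Import Defs.
From Stdlib Require Import Reals Lra List.
Open Scope R_scope.

(** Rescale time so that the period is 1 and suppose [y'] satisfies
    [|y' s - y' t| <= 6 |y s - y t|].  Let [M] be the maximal speed and [C] the
    least constant with [|y (t+h) - y t| <= C h (1-h)].  The identity
    [y (t+h) - y t
       = h (1-h) int_0^1 (y' (t+h-hr) - y' (t+h+(1-h)r)) dr]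
    compares values of [y'] at two times differing by exactly [r], so the
    integrand is at most [6 C r (1-r)], whose integral is [C]; near [r = 0] it is
    also at most [6 M r], which would improve [C] if [C > M].  Hence [C <= M].
    At a time [t0] of maximal speed, with [v = y' t0],
    [v = int_0^1 (v - y' (t0+r)) dr] and the integrals over both halves
    of [[0,1]] have norm at most [M/2]; strict convexity makes both equal to
    [v/2], that is [y (t0 + 1/2) = y t0].  But then the integrand is at most
    [6 M (1/2 - r)] for [r < 1/2], so the first half is shorter than [M/2]
    unless [M = 0]. *)

(** * Linear identities in a normed space *)

Section VectorAlgebra.
Context {X : NormedSpace}.
Implicit Types u v w : X.

Lemma vadd_cancel u v w : vadd u w = vadd v w -> u = v.
Proof.
intros H.
rewrite <- (vadd_0 _ u), <- (vadd_0 _ v), <- (vadd_opp _ w).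
now rewrite !vadd_assoc, H.
Qed.

Lemma vscal_0 u : vscal 0 u = vzero.
Proof.
apply (vadd_cancel _ _ (vscal 0 u)).
rewrite <- vscal_distr_r, (vadd_comm _ vzero), vadd_0.
f_equal; ring.
Qed.

Lemma vopp_scal u : vopp u = vscal (-1) u.
Proof.
apply (vadd_cancel _ _ u).
rewrite vadd_comm, vadd_opp.
rewrite <- (vscal_1 _ u) at 2.
rewrite <- vscal_distr_r, <- (vscal_0 u).
f_equal; ring.
Qed.

Lemma vscal_zero a : vscal a (vzero : X) = vzero.
Proof.
rewrite <- (vscal_0 vzero), vscal_assoc.
f_equal; ring.
Qed.

(** * Linear vector identities by reflection on coefficients *)

Inductive vexpr :=
| VVar (n : nat)
| VZero
| VAdd (e1 e2 : vexpr)
| VOpp (e : vexpr)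
| VScal (a : R) (e : vexpr).

Fixpoint veval (env : list X) (e : vexpr) : X :=
  match e with
  | VVar n => nth n env vzero
  | VZero => vzero
  | VAdd e1 e2 => vadd (veval env e1) (veval env e2)
  | VOpp e => vopp (veval env e)
  | VScal a e => vscal a (veval env e)
  end.

Fixpoint vcoef (e : vexpr) (n : nat) : R :=
  match e with
  | VVar m => if Nat.eqb m n then 1 else 0
  | VZero => 0
  | VAdd e1 e2 => vcoef e1 n + vcoef e2 n
  | VOpp e => - vcoef e n
  | VScal a e => a * vcoef e n
  end.

Fixpoint vcomb (env : list X) (c : nat -> R) : X :=
  match env with
  | nil => vzero
  | u :: env' => vadd (vscal (c 0%nat) u) (vcomb env' (fun n => c (S n)))
  end.

Lemma vcomb_ext env c d :
  (forall n, (n < length env)%nat -> c n = d n) -> vcomb env c = vcomb env d.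
Proof.
revert c d; induction env as [|u env IH]; intros c d H; simpl; auto.
rewrite (H 0%nat) by (simpl; auto with arith).
f_equal; apply IH; intros n Hn; apply H; simpl; auto with arith.
Qed.

Lemma vcomb_zero env : vcomb env (fun _ => 0) = vzero.
Proof.
induction env as [|u env IH]; simpl; auto.
now rewrite IH, vscal_0, vadd_0.
Qed.

Lemma vcomb_add env c d :
  vcomb env (fun n => c n + d n) = vadd (vcomb env c) (vcomb env d).
Proof.
revert c d; induction env as [|u env IH]; intros c d; simpl.
- now rewrite vadd_0.
- rewrite IH, vscal_distr_r, !vadd_assoc; f_equal.
  rewrite <- !vadd_assoc; f_equal; apply vadd_comm.
Qed.

Lemma vcomb_scal env a c :
  vcomb env (fun n => a * c n) = vscal a (vcomb env c).
Proof.
revert c; induction env as [|u env IH]; intros c; simpl.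
- now rewrite vscal_zero.
- now rewrite IH, vscal_distr_v, vscal_assoc.
Qed.

(** An index beyond the environment is harmless: the default of [nth] is [vzero], and [vcomb] never
    reads that coefficient. *)
Lemma vcomb_var env n :
  vcomb env (fun m => if Nat.eqb n m then 1 else 0) = nth n env vzero.
Proof.
revert n; induction env as [|u env IH]; intros [|n]; simpl; auto.
- now rewrite vcomb_zero, vadd_0, vscal_1.
- now rewrite IH, vscal_0, vadd_comm, vadd_0.
Qed.

Lemma veval_comb env e : veval env e = vcomb env (vcoef e).
Proof.
induction e as [n| |e1 IH1 e2 IH2|e IH|a e IH]; simpl.
- now rewrite vcomb_var.
- now rewrite vcomb_zero.
- now rewrite IH1, IH2, vcomb_add.
- rewrite IH, vopp_scal, <- vcomb_scal; apply vcomb_ext; intros n _; ring.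
- now rewrite IH, vcomb_scal.
Qed.

(** Recursive form of a bounded quantifier: for a concrete [n], [simpl] turns it into a finite
    conjunction, one real equation per atom. *)
Fixpoint all_below (n : nat) (P : nat -> Prop) : Prop :=
  match n with
  | O => True
  | S m => P m /\ all_below m P
  end.

Lemma all_belowE n P : all_below n P -> forall m, (m < n)%nat -> P m.
Proof.
induction n as [|n IH]; simpl; intros H m Hm.
- inversion Hm.
- destruct H as [H0 H1]; inversion Hm; subst; auto.
Qed.

(** Both sides have the normal form [vcomb], which depends only on the coefficients of the atoms.
    This reduces a vector identity to real equations that [field] can solve. *)
Lemma veval_eq env e1 e2 :
  all_below (length env) (fun n => vcoef e1 n = vcoef e2 n) ->
  veval env e1 = veval env e2.
Proof.
intros H; rewrite !veval_comb; apply vcomb_ext; exact (all_belowE _ _ H).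
Qed.

End VectorAlgebra.

Ltac vmem u env :=
  lazymatch env with
  | nil => constr:(false)
  | u :: _ => constr:(true)
  | _ :: ?env' => vmem u env'
  end.

Ltac vatoms env t :=
  lazymatch t with
  | vadd ?a ?b => let env := vatoms env a in vatoms env b
  | vsub ?a ?b => let env := vatoms env a in vatoms env b
  | vopp ?a => vatoms env a
  | vscal _ ?a => vatoms env a
  | vzero => env
  | _ => lazymatch vmem t env with
         | true => env
         | false => constr:(t :: env)
         end
  end.

Ltac vindex u env :=
  lazymatch env with
  | u :: _ => constr:(O)
  | _ :: ?env' => let n := vindex u env' in constr:(S n)
  end.

Ltac vreify env t :=
  lazymatch t with
  | vadd ?a ?b =>
      let a := vreify env a in let b := vreify env b in constr:(VAdd a b)
  | vsub ?a ?b =>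
      let a := vreify env a in let b := vreify env b in
      constr:(VAdd a (VOpp b))
  | vopp ?a => let a := vreify env a in constr:(VOpp a)
  | vscal ?r ?a => let a := vreify env a in constr:(VScal r a)
  | vzero => constr:(VZero)
  | _ => let n := vindex t env in constr:(VVar n)
  end.

Ltac vlin :=
  lazymatch goal with
  | |- @eq ?A ?s ?t =>
      let env := vatoms (@nil A) s in
      let env := vatoms env t in
      let s' := vreify env s in
      let t' := vreify env t in
      change (veval env s' = veval env t');
      apply veval_eq; simpl; repeat split; try (field; auto with real)
  end.

(** * Norms and derivatives *)

Section Calculus.
Context {X : NormedSpace}.
Implicit Types (u v w : X) (x : R -> X).

Lemma vnorm_zero : vnorm (vzero : X) = 0.
Proof. rewrite <- (vscal_0 vzero), vnorm_scal, Rabs_R0; ring. Qed.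

Lemma vnorm_opp u : vnorm (vopp u) = vnorm u.
Proof. rewrite vopp_scal, vnorm_scal, Rabs_left by lra; ring. Qed.

Lemma vnorm_ge0 u : 0 <= vnorm u.
Proof.
pose proof (vnorm_triangle _ u (vopp u)) as H.
rewrite vadd_opp, vnorm_zero, vnorm_opp in H; lra.
Qed.

Lemma vnorm_sub_sym u v : vnorm (vsub u v) = vnorm (vsub v u).
Proof. rewrite <- vnorm_opp; f_equal; vlin. Qed.

Lemma vnorm_sub_triangle u v w :
  vnorm (vsub u w) <= vnorm (vsub u v) + vnorm (vsub v w).
Proof.
replace (vsub u w) with (vadd (vsub u v) (vsub v w)) by vlin.
apply vnorm_triangle.
Qed.

Lemma vnorm_le_sub u v : vnorm u <= vnorm v + vnorm (vsub u v).
Proof.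
replace u with (vadd v (vsub u v)) at 1 by vlin.
apply vnorm_triangle.
Qed.

Lemma vnorm_sub_self u : vnorm (vsub u u) = 0.
Proof. replace (vsub u u) with (vzero : X) by vlin. apply vnorm_zero. Qed.

Lemma vsub_eq0 u v : vnorm (vsub u v) = 0 -> u = v.
Proof.
intros H; apply vnorm_eq0 in H.
replace u with (vadd v (vsub u v)) by vlin.
rewrite H; apply vadd_0.
Qed.

(** The difference quotient is multiplied out, so that [h = 0] is allowed and no division occurs. *)
Definition is_deriv x t d : Prop :=
  forall eps, eps > 0 -> exists delta, delta > 0 /\
    forall h, Rabs h < delta ->
      vnorm (vsub (vsub (x (t + h)) (x t)) (vscal h d)) <= eps * Rabs h.

Lemma has_derivative_at_is_deriv x t d :
  has_derivative_at x t d -> is_deriv x t d.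
Proof.
intros H eps Heps; destruct (H eps Heps) as [delta [Hd Hx]].
exists delta; split; auto; intros h Hh.
destruct (Req_dec h 0) as [->|Hh0].
- replace (t + 0) with t by ring.
  rewrite Rabs_R0.
  replace (vsub (vsub (x t) (x t)) (vscal 0 d)) with (vzero : X) by vlin.
  rewrite vnorm_zero; lra.
- specialize (Hx h Hh0 Hh).
  replace (vsub (vsub (x (t + h)) (x t)) (vscal h d))
    with (vscal h (vsub (vscal (/ h) (vsub (x (t + h)) (x t))) d)) by vlin.
  rewrite vnorm_scal, Rmult_comm.
  apply Rmult_le_compat_r; [apply Rabs_pos | lra].
Qed.

Lemma is_deriv_add x1 x2 t d1 d2 :
  is_deriv x1 t d1 -> is_deriv x2 t d2 ->
  is_deriv (fun s => vadd (x1 s) (x2 s)) t (vadd d1 d2).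
Proof.
intros H1 H2 eps Heps.
destruct (H1 (eps / 2)) as [e1 [He1 H1']]; [lra|].
destruct (H2 (eps / 2)) as [e2 [He2 H2']]; [lra|].
exists (Rmin e1 e2); split; [now apply Rmin_pos|].
intros h Hh.
specialize (H1' h (Rlt_le_trans _ _ _ Hh (Rmin_l _ _))).
specialize (H2' h (Rlt_le_trans _ _ _ Hh (Rmin_r _ _))).
eapply Rle_trans; [|apply Rle_trans with (1 := Rplus_le_compat _ _ _ _ H1' H2'); lra].
eapply Rle_trans; [|apply vnorm_triangle].
right; f_equal; vlin.
Qed.

Lemma is_deriv_scal k x t d :
  is_deriv x t d -> is_deriv (fun s => vscal k (x s)) t (vscal k d).
Proof.
intros H eps Heps.
pose proof (Rabs_pos k) as Hk.
(* The summand 1 keeps the denominator positive when [k = 0]. *)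
destruct (H (eps / (Rabs k + 1))) as [e [He H']].
{ apply Rdiv_lt_0_compat; lra. }
exists e; split; auto; intros h Hh; specialize (H' h Hh).
replace (vsub (vsub (vscal k (x (t + h))) (vscal k (x t))) (vscal h (vscal k d)))
  with (vscal k (vsub (vsub (x (t + h)) (x t)) (vscal h d))) by vlin.
rewrite vnorm_scal.
apply Rle_trans with ((Rabs k + 1) * (eps / (Rabs k + 1) * Rabs h)).
- apply Rmult_le_compat; auto using vnorm_ge0; lra.
- right; field; lra.
Qed.

Lemma is_deriv_affine x c k t d :
  is_deriv x (c + k * t) d -> is_deriv (fun s => x (c + k * s)) t (vscal k d).
Proof.
intros H eps Heps.
pose proof (Rabs_pos k) as Hk.
destruct (H (eps / (Rabs k + 1))) as [e [He H']].
{ apply Rdiv_lt_0_compat; lra. }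
exists (e / (Rabs k + 1)); split; [apply Rdiv_lt_0_compat; lra|].
intros h Hh.
pose proof (Rabs_pos h) as Hh0.
assert (Hkh : Rabs (k * h) < e).
{ rewrite Rabs_mult.
  apply Rle_lt_trans with ((Rabs k + 1) * Rabs h); [nra|].
  replace e with ((Rabs k + 1) * (e / (Rabs k + 1))) by (field; lra).
  apply Rmult_lt_compat_l; lra. }
specialize (H' _ Hkh).
replace (c + k * (t + h)) with (c + k * t + k * h) by ring.
replace (vscal h (vscal k d)) with (vscal (k * h) d) by vlin.
eapply Rle_trans; [exact H'|].
rewrite Rabs_mult, <- Rmult_assoc.
apply Rmult_le_compat_r; auto.
apply Rle_trans with (eps / (Rabs k + 1) * (Rabs k + 1)).
- apply Rmult_le_compat_l; [|lra].
  apply Rlt_le, Rdiv_lt_0_compat; lra.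
- right; field; lra.
Qed.

Lemma is_deriv_linear v t : is_deriv (fun s => vscal s v) t v.
Proof.
intros eps Heps; exists 1; split; [lra|]; intros h _.
replace (vsub (vsub (vscal (t + h) v) (vscal t v)) (vscal h v))
  with (vzero : X) by vlin.
rewrite vnorm_zero; pose proof (Rabs_pos h); nra.
Qed.

Lemma is_deriv_ext x1 x2 t d1 d2 :
  (forall s, x1 s = x2 s) -> d1 = d2 -> is_deriv x1 t d1 -> is_deriv x2 t d2.
Proof.
intros Hx <- H eps Heps; destruct (H eps Heps) as [e [He H']].
exists e; split; auto; intros h Hh; rewrite <- !Hx; auto.
Qed.

Lemma is_deriv_lipschitz_at x t d :
  is_deriv x t d -> exists delta, delta > 0 /\ forall h, Rabs h < delta ->
    vnorm (vsub (x (t + h)) (x t)) <= (1 + vnorm d) * Rabs h.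
Proof.
intros H; destruct (H 1) as [e [He H']]; [lra|].
exists e; split; auto; intros h Hh; specialize (H' h Hh).
pose proof (vnorm_le_sub (vsub (x (t + h)) (x t)) (vscal h d)) as Hn.
rewrite vnorm_scal in Hn; lra.
Qed.

(** * The mean value inequality *)

(** Half of [eps] pays for the linearisation of [x], half for that of [g]. Both signs of [h] are
    needed: the supremum argument for the mean value inequality looks left and right of a point. *)
Lemma deriv_local_bound x t d (g : R -> R) g' eps :
  is_deriv x t d -> derivable_pt_lim g t g' -> vnorm d <= g' -> eps > 0 ->
  exists delta, delta > 0 /\ forall h, Rabs h < delta ->
    (0 <= h -> vnorm (vsub (x (t + h)) (x t)) <= g (t + h) - g t + eps * h) /\
    (h <= 0 -> vnorm (vsub (x (t + h)) (x t)) <= g t - g (t + h) - eps * h).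
Proof.
intros Hx Hg Hd Heps.
destruct (Hx (eps / 2)) as [e1 [He1 H1]]; [lra|].
destruct (Hg (eps / 2)) as [e2 H2]; [lra|].
exists (Rmin e1 e2); split; [apply Rmin_pos; auto; apply cond_pos|].
intros h Hh.
specialize (H1 h (Rlt_le_trans _ _ _ Hh (Rmin_l _ _))).
assert (H2' : Rabs (g (t + h) - g t - h * g') <= eps / 2 * Rabs h).
{ destruct (Req_dec h 0) as [->|Hh0].
  - replace (t + 0) with t by ring.
    replace (g t - g t - 0 * g') with 0 by ring.
    rewrite Rabs_R0; lra.
  - specialize (H2 h Hh0 (Rlt_le_trans _ _ _ Hh (Rmin_r _ _))).
    replace (g (t + h) - g t - h * g') with (((g (t + h) - g t) / h - g') * h)
      by (field; auto).
    rewrite Rabs_mult; apply Rmult_le_compat_r; [apply Rabs_pos|lra]. }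
pose proof (vnorm_le_sub (vsub (x (t + h)) (x t)) (vscal h d)) as Hn.
rewrite vnorm_scal in Hn.
pose proof (Rabs_pos h) as Hh0.
assert (Hdh : Rabs h * vnorm d <= Rabs h * g') by nra.
clear H2 Hh; revert H1 H2' Hn Hdh Hh0.
unfold Rabs; destruct (Rcase_abs h), (Rcase_abs (g (t + h) - g t - h * g'));
  intros; split; intros; try lra;
  (* What remains is [h = 0], which satisfies both sign conditions. *)
  assert (h * g' = 0 /\ eps * h = 0) by (replace h with 0 by lra; lra); lra.
Qed.

(** This takes the place of integration. Let [c] be the supremum of the points up to which the bound
    holds with slack [eps * (s - a)]. The local bound to the left of [c] shows that [c] is such a
    point; to the right it passes beyond [c] unless [c = b]. *)
Lemma mean_value_inequality x dx (g g' : R -> R) a b :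
  a <= b ->
  (forall t, is_deriv x t (dx t)) ->
  (forall t, derivable_pt_lim g t (g' t)) ->
  (forall t, a <= t <= b -> vnorm (dx t) <= g' t) ->
  vnorm (vsub (x b) (x a)) <= g b - g a.
Proof.
intros Hab Hx Hg Hb.
apply Rle_plus_epsilon; intros eps0 Heps0.
pose (eps := eps0 / (b - a + 1)).
assert (Heps : eps > 0) by (apply Rdiv_lt_0_compat; lra).
assert (Hloc : forall t, a <= t <= b -> _) by
  (intros t Ht; exact (deriv_local_bound x t (dx t) g (g' t) eps
     (Hx t) (Hg t) (Hb t Ht) Heps)).
pose (S := fun s => a <= s <= b /\
  vnorm (vsub (x s) (x a)) <= g s - g a + eps * (s - a)).
destruct (completeness S) as [c [Hub Hlub]].
{ exists b; intros s [Hs _]; lra. }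
{ exists a; split; [lra|]; rewrite vnorm_sub_self; lra. }
assert (Hac : a <= c).
{ apply Hub; split; [lra|]; rewrite vnorm_sub_self; lra. }
assert (Hcb : c <= b) by (apply Hlub; intros s [Hs _]; lra).
destruct (Hloc c (conj Hac Hcb)) as [delta [Hdelta Hd]].
assert (HSc : S c).
{ assert (Hs : exists s, S s /\ c - delta < s).
  { apply Classical_Prop.NNPP; intros Hn.
    assert (c <= c - delta); [|lra].
    apply Hlub; intros s Hs; apply Rnot_lt_le; intros Hlt.
    apply Hn; exists s; auto. }
  destruct Hs as [s [[Hs1 Hs2] Hs3]].
  assert (Hsc : s <= c) by (apply Hub; split; auto).
  destruct (Hd (s - c)) as [_ H].
  { rewrite Rabs_left1; lra. }
  replace (c + (s - c)) with s in H by ring.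
  rewrite vnorm_sub_sym in H.
  split; [lra|].
  pose proof (vnorm_sub_triangle (x c) (x s) (x a)); specialize (H ltac:(lra)); lra. }
destruct (Rle_lt_or_eq_dec _ _ Hcb) as [Hlt|Heq].
- pose (h := Rmin (delta / 2) (b - c)).
  assert (Hh : 0 < h) by (apply Rmin_pos; lra).
  assert (Hh1 : h <= delta / 2) by apply Rmin_l.
  assert (Hh2 : h <= b - c) by apply Rmin_r.
  destruct (Hd h) as [H _]; [rewrite Rabs_pos_eq; lra|].
  specialize (H ltac:(lra)).
  destruct HSc as [_ HSc].
  assert (c + h <= c); [|lra].
  apply Hub; split; [lra|].
  pose proof (vnorm_sub_triangle (x (c + h)) (x c) (x a)); lra.
- subst c; destruct HSc as [_ HSc].
  eapply Rle_trans; [exact HSc|].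
  assert (eps * (b - a) <= eps0); [|lra].
  replace eps0 with (eps * (b - a + 1)) by (unfold eps; field; lra).
  apply Rmult_le_compat_l; lra.
Qed.

Lemma derivable_pt_lim_cubic a b c t :
  derivable_pt_lim (fun s => a * s + b * s ^ 2 + c * s ^ 3) t
    (a + 2 * b * t + 3 * c * t ^ 2).
Proof.
replace (a + 2 * b * t + 3 * c * t ^ 2)
  with (a * 1 + b * (INR 2 * t ^ 1) + c * (INR 3 * t ^ 2)) by (simpl; ring).
apply (derivable_pt_lim_plus (fun s => a * s + b * s ^ 2) (fun s => c * s ^ 3)).
- apply (derivable_pt_lim_plus (fun s => a * s) (fun s => b * s ^ 2)).
  + apply (derivable_pt_lim_scal id), derivable_pt_lim_id.
  + apply (derivable_pt_lim_scal (fun s => s ^ 2)), (derivable_pt_lim_pow t 2).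
- apply (derivable_pt_lim_scal (fun s => s ^ 3)), (derivable_pt_lim_pow t 3).
Qed.

(** The integrands to come are bounded by quadratics such as [6 C r (1-r)]; their primitives are
    cubics. *)
Lemma mean_value_cubic x dx a b c s t :
  s <= t ->
  (forall r, is_deriv x r (dx r)) ->
  (forall r, s <= r <= t -> vnorm (dx r) <= a + 2 * b * r + 3 * c * r ^ 2) ->
  vnorm (vsub (x t) (x s))
    <= a * (t - s) + b * (t ^ 2 - s ^ 2) + c * (t ^ 3 - s ^ 3).
Proof.
intros Hst Hx Hb.
pose proof (mean_value_inequality x dx
  (fun s => a * s + b * s ^ 2 + c * s ^ 3)
  (fun t => a + 2 * b * t + 3 * c * t ^ 2) s t Hst Hx
  (derivable_pt_lim_cubic a b c) Hb) as H.
lra.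
Qed.

(** The triangle inequality forces both norms to equal half of [vnorm (vadd u w)]. After
    normalisation the midpoint then has norm 1, which strict convexity excludes for distinct unit
    vectors. *)
Lemma strictly_convex_halves (Hsc : strictly_convex X) u w :
  vnorm u <= vnorm (vadd u w) / 2 -> vnorm w <= vnorm (vadd u w) / 2 -> u = w.
Proof.
intros Hu Hw.
pose proof (vnorm_triangle _ u w) as Ht.
destruct (Req_dec (vnorm u) 0) as [H0|H0].
{ rewrite (vnorm_eq0 _ u), (vnorm_eq0 _ w); auto.
  pose proof (vnorm_ge0 w); lra. }
pose proof (vnorm_ge0 u) as Hu0.
set (m := vnorm u) in *.
assert (Hk : 0 < / m) by (apply Rinv_0_lt_compat; lra).
assert (Hn : forall z : X, vnorm z = m -> vnorm (vscal (/ m) z) = 1).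
{ intros z Hz; rewrite vnorm_scal, Rabs_pos_eq, Hz by lra; field; auto. }
destruct (Classical_Prop.classic (vscal (/ m) u = vscal (/ m) w)) as [He|He].
- replace u with (vscal m (vscal (/ m) u)) by vlin.
  rewrite He; vlin.
- assert (Hlt := Hsc _ _ (Hn u eq_refl) (Hn w ltac:(lra)) He).
  rewrite <- vscal_distr_v, vscal_assoc, vnorm_scal, Rabs_pos_eq in Hlt by lra.
  exfalso; replace (vnorm (vadd u w)) with (2 * m) in Hlt by lra.
  replace (1 / 2 * / m * (2 * m)) with 1 in Hlt by (field; auto); lra.
Qed.

End Calculus.

(** * Curves of period 1 with constant 6 *)

Section UnitPeriod.
Context {X : NormedSpace}.
Variables y dy : R -> X.
Hypothesis y_deriv : forall t, is_deriv y t (dy t).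
Hypothesis y_per : forall t, y (t + 1) = y t.
Hypothesis dy_lip :
  forall s t, vnorm (vsub (dy s) (dy t)) <= 6 * vnorm (vsub (y s) (y t)).

Lemma y_perZ (k : Z) t : y (t + IZR k) = y t.
Proof.
revert t; induction k as [|k IH|k IH] using Z.peano_ind; intros t.
- now rewrite Rplus_0_r.
- rewrite succ_IZR, <- Rplus_assoc, y_per; auto.
- rewrite <- (IH t), <- y_per.
  unfold Z.pred; rewrite plus_IZR; f_equal; ring.
Qed.

(** The Lipschitz bound makes velocity a function of position, so [dy] inherits the period of
    [y]. *)
Lemma dy_of_y s t : y s = y t -> dy s = dy t.
Proof.
intros H; apply vsub_eq0, Rle_antisym; [|apply vnorm_ge0].
eapply Rle_trans; [apply dy_lip|].
rewrite H, vnorm_sub_self; lra.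
Qed.

Lemma speed_continuous : continuity (fun t => vnorm (dy t)).
Proof.
intros t eps Heps.
destruct (is_deriv_lipschitz_at _ _ _ (y_deriv t)) as [e [He H]].
set (K := 1 + vnorm (dy t)) in *.
assert (HK : 0 < K) by (pose proof (vnorm_ge0 (dy t)); unfold K; lra).
(* Near [t] the curve [y] moves at rate at most [K], hence [dy] at rate at most [6 * K]. *)
exists (Rmin e (eps / (6 * K))); split.
{ apply Rmin_pos; auto; apply Rdiv_lt_0_compat; lra. }
intros s [_ Hs]; simpl in Hs |- *; unfold Rdist in *.
assert (H1 := H (s - t) (Rlt_le_trans _ _ _ Hs (Rmin_l _ _))).
rewrite Rplus_minus in H1.
assert (H2 := Rlt_le_trans _ _ _ Hs (Rmin_r _ _)).
assert (H3 : 6 * K * Rabs (s - t) < eps).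
{ replace eps with (6 * K * (eps / (6 * K))) by (field; lra).
  apply Rmult_lt_compat_l; lra. }
pose proof (dy_lip s t) as H4.
pose proof (vnorm_le_sub (dy s) (dy t)) as H5.
pose proof (vnorm_le_sub (dy t) (dy s)) as H6.
rewrite vnorm_sub_sym in H6.
apply Rabs_def1; lra.
Qed.

(** A continuous speed has a maximum on [[0,1]], and subtracting the integer part brings every time
    into that interval. *)
Lemma max_speed : exists t0, forall t, vnorm (dy t) <= vnorm (dy t0).
Proof.
destruct (continuity_ab_maj (fun t => vnorm (dy t)) 0 1) as [t0 [Hmax _]].
{ lra. }
{ intros t _; apply speed_continuous. }
exists t0; intros t.
destruct (base_Int_part t) as [H1 H2].
replace (dy t) with (dy (t + IZR (- Int_part t))).
- apply Hmax; rewrite opp_IZR; lra.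
- apply dy_of_y, y_perZ.
Qed.

Lemma displacement_le M s t :
  (forall r, vnorm (dy r) <= M) -> s <= t ->
  vnorm (vsub (y t) (y s)) <= M * (t - s).
Proof.
intros HM Hst.
pose proof (mean_value_cubic y dy M 0 0 s t Hst y_deriv) as H.
rewrite !Rmult_0_l, !Rplus_0_r in H; apply H.
intros r _; specialize (HM r); lra.
Qed.

(** * Displacement over a fraction of the period *)

Section Displacement.
Variable M : R.
Hypothesis speed_le : forall t, vnorm (dy t) <= M.

(** The weight [h (1-h)] vanishes at both ends of a period. Since 6 times its integral over [[0,1]]
    is 1, feeding the bound through the Lipschitz constant 6 returns the same [C]. *)
Definition displacement_bound C : Prop :=
  forall t h, 0 <= h <= 1 ->
    vnorm (vsub (y (t + h)) (y t)) <= C * (h * (1 - h)).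

(* The interpolating curve [p] has [p 1 - p 0 = y (t+h) - y t], and [p' r] is
   [h (1-h)] times a difference of [dy] at times [r] apart. *)
Lemma displacement_bound_improve C :
  0 < C -> M <= C -> displacement_bound C ->
  displacement_bound (C - (1 - M / C) ^ 2 * (C - M)).
Proof.
intros HC HMC Hb t h Hh.
assert (HM0 : 0 <= M) by exact (Rle_trans _ _ _ (vnorm_ge0 _) (speed_le 0)).
set (k := h * (1 - h)).
assert (Hk : 0 <= k) by (unfold k; nra).
pose (p := fun r => vadd (vscal (- (1 - h)) (y (t + h + (- h) * r)))
                         (vscal (- h) (y (t + h + (1 - h) * r)))).
pose (dp := fun r => vscal k (vsub (dy (t + h + (- h) * r))
                                   (dy (t + h + (1 - h) * r)))).
assert (Hp : forall r, is_deriv p r (dp r)).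
{ intros r; unfold p, dp, k.
  eapply is_deriv_ext; [reflexivity| |].
  2: { apply is_deriv_add; apply is_deriv_scal, is_deriv_affine, y_deriv. }
  vlin. }
assert (Hdp : forall r,
  vnorm (dp r) <= k * (6 * vnorm (vsub (y (t + h + - h * r + r))
                                       (y (t + h + - h * r))))).
{ intros r; unfold dp; rewrite vnorm_scal, Rabs_pos_eq by auto.
  apply Rmult_le_compat_l; auto.
  rewrite vnorm_sub_sym.
  replace (t + h + - h * r + r) with (t + h + (1 - h) * r) by ring.
  apply dy_lip. }
(* The two bounds [6 M r] and [6 C r (1-r)] cross at [r = eta]; the first is the smaller one before
   it. *)
set (eta := 1 - M / C).
assert (HMe : M = C * (1 - eta)) by (unfold eta; field; lra).
assert (Heta : 0 <= eta <= 1) by nra.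
assert (H1 : vnorm (vsub (p eta) (p 0)) <= k * (3 * M * eta ^ 2)).
{ replace (k * (3 * M * eta ^ 2))
    with (0 * (eta - 0) + 3 * k * M * (eta ^ 2 - 0 ^ 2) + 0 * (eta ^ 3 - 0 ^ 3))
    by ring.
  apply mean_value_cubic with dp; [lra|auto|].
  intros r Hr; eapply Rle_trans; [apply Hdp|].
  eapply Rle_trans.
  { apply Rmult_le_compat_l; auto; apply Rmult_le_compat_l; [lra|].
    apply displacement_le with (M := M); auto; lra. }
  right; ring. }
assert (H2 : vnorm (vsub (p 1) (p eta))
             <= k * (C * (1 - 3 * eta ^ 2 + 2 * eta ^ 3))).
{ replace (k * (C * (1 - 3 * eta ^ 2 + 2 * eta ^ 3)))
    with (0 * (1 - eta) + 3 * k * C * (1 ^ 2 - eta ^ 2)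
          + (-2 * k * C) * (1 ^ 3 - eta ^ 3)) by ring.
  apply mean_value_cubic with dp; [lra|auto|].
  intros r Hr; eapply Rle_trans; [apply Hdp|].
  eapply Rle_trans.
  { apply Rmult_le_compat_l; auto; apply Rmult_le_compat_l; [lra|].
    apply Hb; lra. }
  right; ring. }
replace (vsub (y (t + h)) (y t)) with (vsub (p 1) (p 0)).
2: { unfold p.
  replace (t + h + - h * 1) with t by ring.
  replace (t + h + (1 - h) * 1) with (t + 1) by ring.
  rewrite y_per, !Rmult_0_r, !Rplus_0_r; vlin. }
eapply Rle_trans; [apply (vnorm_sub_triangle _ (p eta))|].
eapply Rle_trans; [apply Rplus_le_compat; [exact H2|exact H1]|].
(* With [M = C (1 - eta)] the two pieces add up to [k C (1 - eta^3)], and the gain [C eta^3] is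
   [eta^2 (C - M)]. *)
right; rewrite HMe; ring.
Qed.

(** Moving to the nearer end of the period costs at most [M min(h, 1-h)], and
    [min(h, 1-h) <= 2 h (1-h)]. This makes the set of quotients below bounded, so that a least [C]
    exists. *)
Lemma displacement_bound_coarse : displacement_bound (2 * M).
Proof.
intros t h Hh.
pose proof (displacement_le M t (t + h) speed_le ltac:(lra)) as H1.
pose proof (displacement_le M (t + h) (t + 1) speed_le ltac:(lra)) as H2.
rewrite y_per, vnorm_sub_sym in H2.
assert (HM0 : 0 <= M) by exact (Rle_trans _ _ _ (vnorm_ge0 _) (speed_le 0)).
replace (t + h - t) with h in H1 by ring.
replace (t + 1 - (t + h)) with (1 - h) in H2 by ring.
destruct (Rle_dec h (1 / 2)).
- eapply Rle_trans; [exact H1|].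
  assert (0 <= M * h) by nra; nra.
- eapply Rle_trans; [exact H2|].
  assert (0 <= M * (1 - h)) by nra; nra.
Qed.

Lemma displacement_bound_max_speed : displacement_bound M.
Proof.
assert (Hends : forall t h, h = 0 \/ h = 1 -> vnorm (vsub (y (t + h)) (y t)) = 0).
{ intros t h [-> | ->]; rewrite ?Rplus_0_r, ?y_per; apply vnorm_sub_self. }
(* The least admissible constant is the supremum of these quotients. The ends [h = 0] and [h = 1],
   where the weight vanishes, are covered by [Hends]. *)
pose (E := fun q => exists t h, 0 < h < 1 /\
  q = vnorm (vsub (y (t + h)) (y t)) / (h * (1 - h))).
assert (HE : forall C, displacement_bound C <-> is_upper_bound E C).
{ intros C; split.
  - intros Hb q [t [h [Hh ->]]].
    assert (0 < h * (1 - h)) by nra.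
    apply Rmult_le_reg_r with (h * (1 - h)); auto.
    unfold Rdiv; rewrite Rmult_assoc, Rinv_l, Rmult_1_r by lra.
    apply Hb; lra.
  - intros Hub t h Hh.
    destruct (Req_dec h 0) as [H0|H0].
    { rewrite Hends by auto; rewrite H0; lra. }
    destruct (Req_dec h 1) as [H1|H1].
    { rewrite Hends by auto; rewrite H1; lra. }
    assert (0 < h * (1 - h)) by nra.
    assert (Hq : vnorm (vsub (y (t + h)) (y t)) / (h * (1 - h)) <= C).
    { apply Hub; exists t, h; split; auto; lra. }
    apply Rmult_le_compat_r with (r := h * (1 - h)) in Hq; [|lra].
    unfold Rdiv in Hq; rewrite Rmult_assoc, Rinv_l, Rmult_1_r in Hq; lra. }
destruct (completeness E) as [C [Hub Hlub]].
{ exists (2 * M); apply HE, displacement_bound_coarse. }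
{ eexists; exists 0, (1 / 2); split; [lra|reflexivity]. }
assert (HM0 : 0 <= M) by exact (Rle_trans _ _ _ (vnorm_ge0 _) (speed_le 0)).
destruct (Rle_lt_dec C M) as [Hle|Hlt].
{ apply HE; intros q Hq; apply Rle_trans with C; auto. }
exfalso.
assert (HC : 0 < C) by lra.
(* Were [C > M], the improved constant would be strictly below the least one. *)
assert (Himp : C <= C - (1 - M / C) ^ 2 * (C - M)).
{ apply Hlub, HE, displacement_bound_improve; [lra|lra|now apply HE]. }
assert (Hr : 0 < 1 - M / C).
{ replace (1 - M / C) with ((C - M) / C) by (field; lra).
  apply Rdiv_lt_0_compat; lra. }
assert (0 < (1 - M / C) ^ 2 * (C - M)); [|lra].
apply Rmult_lt_0_compat; [apply pow_lt|]; lra.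
Qed.

End Displacement.

Lemma max_speed_zero (Hsc : strictly_convex X) t0 :
  (forall t, vnorm (dy t) <= vnorm (dy t0)) -> vnorm (dy t0) = 0.
Proof.
intros Hmax.
set (v := dy t0) in *; set (M := vnorm v) in *.
assert (HM0 : 0 <= M) by apply vnorm_ge0.
pose proof (displacement_bound_max_speed M Hmax) as Hb.
(* A primitive of [v - dy (t0 + r)]; by periodicity its increment over [[0,1]] is [v]. The factor 1
   matches the form required by [is_deriv_affine]. *)
pose (p := fun r => vadd (vscal r v) (vscal (-1) (y (t0 + 1 * r)))).
pose (dp := fun r => vsub v (dy (t0 + r))).
assert (Hp : forall r, is_deriv p r (dp r)).
{ intros r; unfold p, dp.
  eapply is_deriv_ext; [reflexivity| |].
  2: { apply is_deriv_add; [apply is_deriv_linear|].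
       apply is_deriv_scal, is_deriv_affine, y_deriv. }
  rewrite Rmult_1_l; vlin. }
assert (Hdp : forall r, vnorm (dp r) <= 6 * vnorm (vsub (y (t0 + r)) (y t0))).
{ intros r; unfold dp, v; rewrite (vnorm_sub_sym (y _)); apply dy_lip. }
assert (Hseg : forall a b, 0 <= a <= b -> b <= 1 ->
  vnorm (vsub (p b) (p a)) <= M * (3 * (b ^ 2 - a ^ 2) - 2 * (b ^ 3 - a ^ 3))).
{ intros a b Ha Hb1.
  replace (M * (3 * (b ^ 2 - a ^ 2) - 2 * (b ^ 3 - a ^ 3)))
    with (0 * (b - a) + 3 * M * (b ^ 2 - a ^ 2) + (-2 * M) * (b ^ 3 - a ^ 3))
    by ring.
  apply mean_value_cubic with dp; [lra|auto|].
  intros r Hr; eapply Rle_trans; [apply Hdp|].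
  specialize (Hb t0 r ltac:(lra)); lra. }
set (A := vsub (p (1 / 2)) (p 0)); set (B := vsub (p 1) (p (1 / 2))).
assert (HAB : vadd A B = v).
{ unfold A, B, p; rewrite Rmult_1_r, y_per, Rmult_0_r, Rplus_0_r; vlin. }
assert (Hhalf : A = B).
(* The cubic [3 r^2 - 2 r^3] grows by exactly 1/2 over each half, so each increment has norm at most
   [M/2] while their sum has norm [M]. *)
{ apply strictly_convex_halves; auto; rewrite HAB; fold M.
  - eapply Rle_trans; [apply Hseg; lra|]; lra.
  - eapply Rle_trans; [apply Hseg; lra|]; lra. }
assert (HA : A = vscal (1 / 2) v).
{ rewrite <- HAB, <- Hhalf; vlin. }
(* [A] equals [v/2] minus the displacement over half a period, which must therefore vanish. *)
assert (Hy : y (t0 + 1 / 2) = y t0).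
{ replace (y (t0 + 1 / 2)) with (vadd (y t0) (vsub (vscal (1 / 2) v) A)).
  - rewrite HA; vlin.
  - unfold A, p; rewrite Rmult_1_l, Rmult_0_r, Rplus_0_r; vlin. }
(* The bound [6 M r (1-r)] is used up to 2/5, then [6 M (1/2 - r)], which holds because [y] is back
   at [y t0] at half time. The integrals 0.352 and 0.03 add up to less than 1/2, whereas [A] has
   norm [M/2]. *)
assert (HA1 : vnorm (vsub (p (2 / 5)) (p 0)) <= 352 / 1000 * M).
{ eapply Rle_trans; [apply Hseg; lra|]; lra. }
assert (HA2 : vnorm (vsub (p (1 / 2)) (p (2 / 5))) <= 30 / 1000 * M).
{ eapply Rle_trans.
  { apply (mean_value_cubic p dp (3 * M) (-3 * M) 0); [lra|auto|].
    intros r Hr; eapply Rle_trans; [apply Hdp|].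
    rewrite <- Hy, vnorm_sub_sym.
    pose proof (displacement_le M (t0 + r) (t0 + 1 / 2) Hmax ltac:(lra)); lra. }
  lra. }
pose proof (vnorm_sub_triangle (p (1 / 2)) (p (2 / 5)) (p 0)) as HA3.
fold A in HA3; rewrite HA, vnorm_scal, Rabs_pos_eq in HA3 by lra.
fold M in HA3; lra.
Qed.

Lemma unit_period_constant (Hsc : strictly_convex X) s t : y s = y t.
Proof.
destruct max_speed as [t0 Ht0].
pose proof (max_speed_zero Hsc t0 Ht0) as H0.
assert (Hle : forall a b, a <= b -> y b = y a).
{ intros a b Hab; apply vsub_eq0, Rle_antisym; [|apply vnorm_ge0].
  eapply Rle_trans; [apply (displacement_le _ a b Ht0 Hab)|]; rewrite H0; lra. }
destruct (Rle_dec s t); [symmetry|]; apply Hle; lra.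
Qed.

End UnitPeriod.

(** * Rescaling an arbitrary period to 1 *)

Theorem theorem1 (X : NormedSpace) (HX : complete X) (Hsc : strictly_convex X)
  (f : X -> X) (L : R) (Hf : lipschitz f L)
  (x : R -> X) (T : R) (HT : T > 0)
  (Hsol : solves_ode f x)
  (Hper : forall t, x (t + T) = x t)
  (Hnc : exists s t, x s <> x t) :
  T * L > 6.
Proof.
apply Rnot_le_gt; intros HTL.
destruct Hnc as [s [t Hst]]; apply Hst.
(* In the rescaled time the velocity has Lipschitz constant [T * L <= 6] with respect to position.
   The summand 0 fits the affine form [c + k * s]. *)
pose (y := fun r => x (0 + T * r)).
pose (dy := fun r => vscal T (f (x (0 + T * r)))).
assert (Hy : forall r, x r = y (r / T)).
{ intros r; unfold y; f_equal; field; lra. }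
rewrite (Hy s), (Hy t).
apply (unit_period_constant y dy); auto.
- intros r; apply is_deriv_affine, has_derivative_at_is_deriv, Hsol.
- intros r; unfold y; rewrite <- (Hper (0 + T * r)); f_equal; ring.
- intros a b; unfold dy, y.
  replace (vsub (vscal T (f (x (0 + T * a)))) (vscal T (f (x (0 + T * b)))))
    with (vscal T (vsub (f (x (0 + T * a))) (f (x (0 + T * b))))) by vlin.
  rewrite vnorm_scal, Rabs_pos_eq by lra.
  eapply Rle_trans; [apply Rmult_le_compat_l; [lra|apply Hf]|].
  rewrite <- Rmult_assoc; apply Rmult_le_compat_r; [apply vnorm_ge0|lra].
Qed.
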